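(* For every integer $n>1$, the Borel oriented chromatic number of the directed Schreier graph $\vec F(2^{\mathbb Z^n})$ is $\chi_{Bo}(\vec F(2^{\mathbb Z^n}))=5$.
   Context: A directed graph (digraph) $D$ is an irreflexive binary relation $A(D)$ (the arc set) on a vertex set $V(D)$; an arc $(x,y)$ is written $x\to y$. An oriented graph is a digraph whose arc relation is asymmetric. A graph homomorphism between digraphs is a map of vertices sending every arc to an arc. $2^{\mathbb Z^n}=\{0,1\}^{\mathbb Z^n}$ carries the product topology and the shift action $(g\cdot x)(h)=x(h+g)$ for $g,h\in\mathbb Z^n$. Its free part is $F(2^{\mathbb Z^n})=\{x: g\cdot x\neq x \text{ for every } g\neq 0\}$, a Polish space. With $e_1,\dots,e_n$ the standard generators of $\mathbb Z^n$, the directed Schreier graph $\vec F(2^{\mathbb Z^n})$ has vertex set $F(2^{\mathbb Z^n})$ and arcs $x\to e_i\cdot x$ for all $x$ and $1\le i\le n$; it is an oriented graph. The Borel oriented chromatic number $\chi_{Bo}(G)$ of an oriented graph $G$ on a Polish space is the least $|V(H)|$ over finite oriented graphs $H$ for which there is a Borel graph homomorphism $G\to H$. *)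

(* Defs.v *)
From HB Require Import structures.
From mathcomp Require Import all_boot all_order all_algebra.
From mathcomp Require Import all_classical all_reals all_analysis.

Set Implicit Arguments.
Unset Strict Implicit.
Unset Printing Implicit Defensive.

Import Order.TTheory GRing.Theory Num.Theory.

Local Open Scope classical_set_scope.
Local Open Scope ring_scope.

Record digraph (V : Type) := Digraph {
  arc :> V -> V -> Prop;
  arc_irreflexive : forall x, ~ arc x x }.

Definition asymmetric_arcs (V : Type) (A : V -> V -> Prop) : Prop :=
  forall x y, A x y -> ~ A y x.

Record orientedGraph (V : Type) := OrientedGraph {
  digraph_of :> digraph V;
  arc_asymmetric : asymmetric_arcs (arc digraph_of) }.

Definition graph_hom (V W : Type) (G : digraph V) (H : digraph W)
    (f : V -> W) : Prop :=
  forall x y, arc G x y -> arc H (f x) (f y).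

Definition borel_set (X : topologicalType) (A : set X) : Prop :=
  <<s @open X >> A.

(* The finite target is discrete, so all of its subsets are Borel. *)
Definition borel_to_finite (X : topologicalType) (W : finType)
    (f : X -> W) : Prop :=
  forall B : set W, borel_set (f @^-1` B).

Definition borel_oriented_sizes (X : topologicalType) (G : orientedGraph X) :
    set nat :=
  [set k | exists (W : finType) (H : orientedGraph W),
    #|W| = k /\ exists2 f : X -> W, borel_to_finite f & graph_hom G H f].

(* [chi_Bo] is a relation, and not a function, because there may be no finite
   target at all. *)
Definition chi_Bo (X : topologicalType) (G : orientedGraph X) (k : nat) :
    Prop :=
  borel_oriented_sizes G k /\
  forall m, borel_oriented_sizes G m -> (k <= m)%N.

(* The group Z^n is ['rV[int]_n]; [bool] carries the discrete topology. *)
Notation cube n := (prod_topology (fun _ : 'rV[int]_n => bool)).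

Definition shift (n : nat) (g : 'rV[int]_n) (x : cube n) : cube n :=
  fun h => x (h + g).

Lemma shiftD (n : nat) (g g' : 'rV[int]_n) (x : cube n) :
  shift g (shift g' x) = shift (g + g') x.
Proof. by apply/funext => h; rewrite /shift addrA. Qed.

Definition free_part (n : nat) : set (cube n) :=
  [set x | forall g : 'rV[int]_n, g != 0 -> shift g x <> x].
Arguments free_part : clear implicits.

Lemma free_part_shift (n : nat) (g : 'rV[int]_n) (x : cube n) :
  free_part n x -> free_part n (shift g x).
Proof.
move=> Fx g' g'0 /(congr1 (shift (- g))).
rewrite !shiftD addrAC addNr add0r => e; apply: (Fx g' g'0); rewrite e.
by apply/funext => h; rewrite /shift addr0.
Qed.

Definition gen (n : nat) (i : 'I_n) : 'rV[int]_n := delta_mx 0 i.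

(* [free_part n], seen as a type, carries the subspace topology. *)
Definition schreier_arc (n : nat) (x y : free_part n) : Prop :=
  exists i : 'I_n, val y = shift (gen i) (val x).

Lemma schreier_asymmetric (n : nat) : asymmetric_arcs (@schreier_arc n).
Proof.
move=> x y [i yE] [j xE]; move: (set_valP x) => /(_ (gen j + gen i)).
rewrite -shiftD -yE -xE; apply => //.
apply/eqP => /rowP /(_ i); rewrite !mxE !eqxx /=.
by case: (i == j).
Qed.

Lemma schreier_irreflexive (n : nat) (x : free_part n) : ~ schreier_arc x x.
Proof. by move=> xx; apply: (schreier_asymmetric xx). Qed.

Definition schreier_digraph (n : nat) : digraph (free_part n) :=
  Digraph (@schreier_irreflexive n).

Definition schreier_graph (n : nat) : orientedGraph (free_part n) :=
  @OrientedGraph _ (schreier_digraph n) (@schreier_asymmetric n).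

(* Main.v *)
Require Import Defs.
From mathcomp Require Import all_boot all_order all_algebra.
From mathcomp Require Import all_classical all_reals all_analysis.
From mathcomp Require Import zify ring lra.

Set Implicit Arguments.
Unset Strict Implicit.
Unset Printing Implicit Defensive.

Import Order.TTheory GRing.Theory Num.Theory.

Local Open Scope classical_set_scope.
Local Open Scope ring_scope.

Local Notation shift := Defs.shift.

(** The proof has two halves: a Borel homomorphism to a tournament on [5]
    vertices, and a Baire category argument against [4] vertices.

    Five vertices suffice. The target is the tournament on the integers
    modulo [5] with arcs [a -> a + 1] and [a -> a + 2]. A rational function
    on an orbit whose increments along the generators all lie in [[1, 2]]
    becomes a homomorphism after taking integer parts modulo [5]
    ([mod5_arc]), and only its values modulo [5] matter. A linear function
    of slope [3/2] has such increments, with room [1/2] to spare, but it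
    needs an origin, and no Borel rule picks one in every orbit. Instead
    each orbit carries sparse sets of markers at scales [r_k] that grow
    geometrically. Around a marker [m] of level [k] the current function is
    replaced by the linear function that starts at [m], shifted by the
    multiple of [5] that brings it near the current value at [m], with a
    gradual passage from one to the other on the annulus between the
    distances [3 r_k] and [4 r_k] ([blend]). Doing so for all levels, the
    coarse ones first ([tower]), creates slope errors that are summable and
    stay within [1/2] ([drift_tower]). Within [2 r_k] of a level [k] marker
    the result modulo [5] has forgotten both the origin and all the coarser
    levels ([tower_core]), because replacing a function by its shift by a
    multiple of [5] passes through every later step ([agree_tower]). So the
    colour of a point near a marker of some level is well defined and local,
    hence Borel.

    It remains to place the markers so that every point, together with its
    neighbours, is near one. Disjoint balls of one radius cannot cover an
    orbit, but a number of families of far apart balls that depends on [n]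
    alone can ([layers_cover]), by a packing bound. By the pigeonhole principle some
    layer index is used near a given point at infinitely many levels. Which
    indices have this property depends on the orbit only, so every orbit
    keeps the layers of the least such index and drops the others ([level]).

    Four vertices do not suffice. Call two distinct vertices linked if they
    have a common in-neighbour and a common out-neighbour. A linked pair and
    its two witnesses exhaust a four-vertex graph, and then no other pair is
    linked ([linked_unique]); so equal or linked is an equivalence relation,
    with classes of size at most two. If [f] is a homomorphism and [e0],
    [e1] are two generators, then [f (e0 x)] and [f (e1 x)] are equal or
    linked, through [f x] and [f (e0 e1 x)]. The class of [f] is therefore
    invariant under [e0 - e1], which acts topologically transitively, so
    that one class is taken on a comeagre set ([invariant_thinC]). At a
    generic [x] the path [f x -> f (e0 x) -> f (e0 e0 x)] stays inside that
    class, which two vertices leave no room for ([no_twin_path]). *)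

(** * The word norm and functions of nearly constant slope *)

Definition nrm (n : nat) (g : 'rV[int]_n) : nat := (\sum_i `|g 0%R i|)%N.

Lemma nrm0 n : nrm (0 : 'rV[int]_n) = 0%N.
Proof. by rewrite /nrm big1 // => i _; rewrite mxE. Qed.

Lemma nrmN n (g : 'rV[int]_n) : nrm (- g) = nrm g.
Proof. by apply: eq_bigr => i _; rewrite mxE abszN. Qed.

Lemma nrmD n (g h : 'rV[int]_n) : (nrm (g + h) <= nrm g + nrm h)%N.
Proof.
rewrite /nrm -big_split /=; apply: leq_sum => i _; rewrite mxE.
by move: (g 0 i) (h 0 i) => a b; lia.
Qed.

Lemma nrmB n (g h : 'rV[int]_n) : nrm (g - h) = nrm (h - g).
Proof. by rewrite -nrmN opprB. Qed.

Lemma nrm_triangle n (h g k : 'rV[int]_n) :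
  (nrm (g - k) <= nrm (g - h) + nrm (h - k))%N.
Proof. by have := nrmD (g - h) (h - k); rewrite addrA subrK. Qed.

Lemma nrm_gen n (i : 'I_n) : nrm (gen i) = 1%N.
Proof.
rewrite /nrm (bigD1 i) //= big1 ?mxE ?eqxx //.
by move=> j ji; rewrite mxE (negbTE ji).
Qed.

Lemma nrm_eq0 n (g : 'rV[int]_n) : nrm g = 0%N -> g = 0.
Proof.
move=> /eqP; rewrite sum_nat_eq0 => /forallP g0.
by apply/rowP => i; rewrite mxE; have := g0 i; rewrite absz_eq0 => /eqP.
Qed.

Lemma nrm_pred n (g : 'rV[int]_n) k : nrm g = k.+1 ->
  exists i, nrm (g - gen i) = k \/ nrm (g + gen i) = k.
Proof.
move=> gk.
have /existsP[i gi] : [exists i, g 0 i != 0].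
  apply/contraT; rewrite negb_exists => /forallP g0.
  move: gk; rewrite /nrm big1 // => i _.
  by have := g0 i; rewrite negbK => /eqP ->.
have E (h : 'rV[int]_n) : (forall j, j != i -> h 0 j = g 0 j) ->
    (nrm h + `|g 0%R i| = nrm g + `|h 0%R i|)%N.
  move=> hg; rewrite /nrm (bigD1 i) //= [in RHS](bigD1 i) //=.
  rewrite (eq_bigr (fun j => `|g 0%R j|%N)); last by move=> j /hg ->.
  by lia.
exists i; have [gp|gn] : 0 < g 0 i \/ g 0 i < 0 by lia.
- left; have := E (g - gen i); rewrite !mxE !eqxx /= gk.
  suff H : forall j, j != i -> (g - gen i) 0 j = g 0 j by move=> /(_ H); lia.
  by move=> j ji; rewrite !mxE (negbTE ji) subr0.
- right; have := E (g + gen i); rewrite !mxE !eqxx /= gk.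
  suff H : forall j, j != i -> (g + gen i) 0 j = g 0 j by move=> /(_ H); lia.
  by move=> j ji; rewrite !mxE (negbTE ji) addr0.
Qed.

Definition rise (n : nat) (g : 'rV[int]_n) : rat :=
  3%:R / 2%:R * (\sum_i g 0 i)%:~R.

Lemma rise0 n : rise (0 : 'rV[int]_n) = 0.
Proof. by rewrite /rise big1 ?mulr0 // => i _; rewrite mxE. Qed.

Lemma riseD n (g h : 'rV[int]_n) : rise (g + h) = rise g + rise h.
Proof.
rewrite /rise -mulrDr -intrD -big_split /=; congr (_ * _%:~R).
by apply: eq_bigr => i _; rewrite mxE.
Qed.

Lemma riseN n (g : 'rV[int]_n) : rise (- g) = - rise g.
Proof. by apply/eqP; rewrite -addr_eq0 -riseD addNr rise0. Qed.

Lemma rise_gen n (i : 'I_n) : rise (gen i) = 3%:R / 2%:R.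
Proof.
rewrite /rise (bigD1 i) //= big1 ?mxE ?eqxx /= ?addr0 ?mulr1 //.
by move=> j ji; rewrite mxE (negbTE ji).
Qed.

(** The deviation of the increments from [3/2], the middle of [[1, 2]]. *)
Definition drift (n : nat) (b : rat) (T : 'rV[int]_n -> rat) : Prop :=
  forall (g : 'rV[int]_n) i, `|T (g + gen i) - T g - 3%:R / 2%:R| <= b.

Lemma drift_far n b (T : 'rV[int]_n -> rat) g h : drift b T ->
  `|T g - T h - rise (g - h)| <= b * (nrm (g - h))%:R.
Proof.
move=> bT; move E : (nrm (g - h)) => k.
elim: k g E => [|k IH] g E.
  have /eqP := nrm_eq0 E; rewrite subr_eq0 => /eqP ->.
  by rewrite !subrr rise0 subrr normr0 mulr0.
have [i [Ei|Ei]] := nrm_pred E.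
- have [z gE] : exists z, g = z + gen i by exists (g - gen i); rewrite subrK.
  rewrite gE in Ei *; have hE : z + gen i - h = z - h + gen i by rewrite addrAC.
  rewrite hE addrK in Ei; have := IH z Ei; have := bT z i.
  rewrite hE [in X in _ -> _ -> X]riseD rise_gen (mulrS 1 k) mulrDr mulr1.
  rewrite !ler_norml; lra.
- have [z gE] : exists z, g = z - gen i by exists (g + gen i); rewrite addrK.
  rewrite gE in Ei *; have hE : z - gen i - h = z - h - gen i by rewrite addrAC.
  rewrite hE subrK in Ei; have := IH z Ei; have := bT (z - gen i) i.
  rewrite subrK hE [in X in _ -> _ -> X]riseD riseN rise_gen (mulrS 1 k).
  rewrite mulrDr mulr1 !ler_norml; lra.
Qed.

(** * Blending at one scale *)

(** A cut-off with slope [1 / r], equal to [1] up to the distance [3 r] and to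
    [0] from [4 r] on. *)
Definition plateau (r d : nat) : rat :=
  Num.max 0 (Num.min 1 (4%:R - d%:R / r%:R)).

Lemma plateau_ge0 r d : 0 <= plateau r d.
Proof. by rewrite /plateau le_max lexx. Qed.

Lemma plateau_le1 r d : plateau r d <= 1.
Proof. by rewrite /plateau ge_max ler01 ge_min lexx. Qed.

Lemma plateau1 r d : (0 < r)%N -> (d <= 3 * r)%N -> plateau r d = 1.
Proof.
move=> r0 dr; have r0' : 0 < r%:R :> rat by rewrite ltr0n.
have : d%:R / r%:R <= 3%:R :> rat by rewrite ler_pdivrMr // -natrM ler_nat.
by rewrite /plateau => dr3; rewrite min_l ?max_r //; lra.
Qed.

Lemma plateau0 r d : (0 < r)%N -> (4 * r <= d)%N -> plateau r d = 0.
Proof.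
move=> r0 dr; have r0' : 0 < r%:R :> rat by rewrite ltr0n.
have : 4%:R <= d%:R / r%:R :> rat by rewrite ler_pdivlMr // -natrM ler_nat.
by rewrite /plateau => dr4; rewrite max_l // ge_min; apply/orP; right; lra.
Qed.

Lemma plateau_lip r d d' : (0 < r)%N -> (d <= d'.+1)%N -> (d' <= d.+1)%N ->
  `|plateau r d - plateau r d'| <= r%:R^-1.
Proof.
move=> r0 dd' d'd; have r0' : 0 < (r%:R)^-1 :> rat by rewrite invr_gt0 ltr0n.
rewrite -(ler_nat rat) -natr1 in dd'; rewrite -(ler_nat rat) -natr1 in d'd.
have h1 : (d%:R - d'%:R) * r%:R^-1 <= r%:R^-1 :> rat by rewrite ger_pMl //; lra.
have h2 : (d'%:R - d%:R) * r%:R^-1 <= r%:R^-1 :> rat by rewrite ger_pMl //; lra.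
rewrite ler_norml.
rewrite /plateau /Num.max /Num.min.
by do 4?case: ifPn; rewrite ?ltNge ?negbK; lra.
Qed.

Section Blend.
Variables (n : nat) (r : nat).
Implicit Types (S : 'rV[int]_n -> Prop) (T : 'rV[int]_n -> rat).
Implicit Types (g h m : 'rV[int]_n).

Definition sparse (d : nat) S : Prop :=
  forall g h, S g -> S h -> (nrm (g - h) <= d)%N -> g = h.

(** The linear function to which [T] is pulled starts at [m] with a multiple of
    [5] at most [T m], so that it differs from [T] by less than [5] there. *)
Definition patch T m g : rat :=
  T g + plateau r (nrm (g - m))
    * (rise (g - m) + 5%:R * (Num.floor (T m / 5%:R))%:~R - T g).

Definition blend S T g : rat :=
  let near_g := [set m | S m /\ (nrm (g - m) <= 4 * r)%N] in
  if `[< exists m, near_g m >] then patch T (xget g near_g) g else T g.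

Hypothesis r0 : (0 < r)%N.

(** The formula of [m] is also right a little outside the ball of radius
    [4 r], where the cut-off vanishes: the two ends of an arc that crosses the
    sphere can then be treated with the same marker. *)
Lemma blend_near S T m g : sparse (9 * r) S -> S m ->
  (nrm (g - m) <= 5 * r)%N ->
  blend S T g = patch T m g.
Proof.
move=> Ssp Sm gm; rewrite /blend; case: asboolP => [[m' m'g]|no].
  case: xgetP => [m'' _ [Sm'' gm'']|/(_ m')//]; congr (patch T _ g).
  apply: Ssp => //; apply: leq_trans (nrm_triangle g _ _) _.
  by rewrite nrmB; lia.
rewrite /patch plateau0 ?mul0r ?addr0 //; rewrite leqNgt; apply/negP => gm'.
by apply: no; exists m; split => //; lia.
Qed.

Lemma blend_far S T g : (forall m, S m -> (4 * r < nrm (g - m))%N) ->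
  blend S T g = T g.
Proof.
move=> far; rewrite /blend; case: asboolP => // -[m [/far]].
by rewrite ltnNge => /negbTE ->.
Qed.

(** The blended increment is a convex combination of the old one and of [3/2],
    plus the increment of the cut-off, at most [1 / r], times the difference of
    the two functions. That difference is at most [5] at the marker and, by
    [drift_far], at most [5 + 5 r b] where the cut-off varies. *)
Lemma drift_blend b S T : 0 <= b -> sparse (9 * r) S -> drift b T ->
  drift (6%:R * b + 5%:R / r%:R) (blend S T).
Proof.
move=> b0 Ssp bT g i.
have ri0 : 0 < (r%:R)^-1 :> rat by rewrite invr_gt0 ltr0n.
have [[m [Sm gm]]|far] := pselect (exists m, S m /\
    (nrm (g - m) <= 4 * r \/ nrm (g + gen i - m) <= 4 * r)%N).
  have s1 : (nrm (g + gen i - m) <= (nrm (g - m)).+1)%N.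
    by rewrite addrAC; apply: leq_trans (nrmD _ _) _; rewrite nrm_gen addn1.
  have s2 : (nrm (g - m) <= (nrm (g + gen i - m)).+1)%N.
    have -> : g - m = g + gen i - m - gen i by rewrite addrAC addrK.
    by apply: leq_trans (nrmD _ _) _; rewrite nrmN nrm_gen addn1.
  rewrite !(@blend_near S T m) //; try lia.
  rewrite /patch; have := plateau_lip r0 s1 s2.
  have := plateau_ge0 r (nrm (g + gen i - m)).
  have := plateau_le1 r (nrm (g + gen i - m)).
  have := bT g i; have := drift_far g m bT.
  rewrite [g + gen i - m]addrAC (riseD (g - m) (gen i)) rise_gen.
  have : b * (nrm (g - m))%:R <= 5%:R * (b * r%:R).
    by rewrite mulrCA ler_wpM2l // -natrM ler_nat; lia.
  have := floor_le (T m / 5%:R); have := floorD1_gt (T m / 5%:R).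
  rewrite intrD; set F := (Num.floor _)%:~R.
  set p' := plateau _ _; set p := plateau _ _.
  move: (T (g + gen i)) (T g) (T m) (rise _) => t' t t0 R.
  move: (nrm (g - m))%:R => N F1 F2 Nr D1 D2 p1 p0 pp.
  have D : `|R + 5%:R * F - t| <= 5%:R + 5%:R * (b * r%:R).
    by move: D1; rewrite !ler_norml; lra.
  (* convex combination of the increments, plus the increment of the cut-off *)
  have -> : t' + p' * (R + 3%:R/2%:R + 5%:R * F - t')
    - (t + p * (R + 5%:R * F - t)) - 3%:R / 2%:R
    = (1 - p') * (t' - t - 3%:R / 2%:R) + (p' - p) * (R + 5%:R * F - t).
    by field.
  apply: le_trans (ler_normD _ _) _; rewrite !normrM.
  have h1 : `|1 - p'| * `|t' - t - 3%:R / 2%:R| <= 1 * b.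
    by apply: ler_pM => //; rewrite ler_norml; lra.
  have h2 : `|p' - p| * `|R + 5%:R * F - t|
      <= r%:R^-1 * (5%:R + 5%:R * (b * r%:R)).
    by apply: ler_pM.
  have h3 : r%:R^-1 * (5%:R + 5%:R * (b * r%:R)) = 5%:R / r%:R + 5%:R * b.
    by field; rewrite pnatr_eq0 -lt0n.
  move: h1 h2; rewrite mul1r h3; lra.
rewrite !blend_far; try by move=> m Sm; rewrite ltnNge; apply/negP => gm;
  apply: far; exists m; split; auto.
have := bT g i; have : 0 <= 5%:R / r%:R :> rat by rewrite mulr_ge0 ?ltW.
by lra.
Qed.

(** Equality modulo [5] on a ball, with one multiple of [5] for the whole
    ball. *)
Definition agree (N : int) (y : 'rV[int]_n) (R : nat) T T' :=
  forall z : 'rV[int]_n, (nrm (z - y) <= R)%N -> T z = T' z + 5%:R * N%:~R.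

(** The marker that acts on a point lies within [4 r] of it, and the chosen
    multiple of [5] follows a shift of [T] by a multiple of [5]. *)
Lemma agree_blend N y R S T T' : sparse (9 * r) S ->
  agree N y (R + 4 * r) T T' -> agree N y R (blend S T) (blend S T').
Proof.
move=> Ssp TT' z zy.
have [[m [Sm zm]]|far] := pselect (exists m, S m /\ (nrm (z - m) <= 4 * r)%N).
  rewrite !(@blend_near S _ m) //; try lia.
  rewrite /patch TT'; last by lia.
  rewrite (TT' m); last first.
    apply: leq_trans (nrm_triangle z _ _) _; rewrite nrmB [leqRHS]addnC.
    exact: leq_add.
  have -> : (T' m + 5%:R * N%:~R) / 5%:R = T' m / 5%:R + N%:~R by field.
  by rewrite floorDrz ?intr_int // intrKfloor intrD; ring.
have {}far : forall m, S m -> (4 * r < nrm (z - m))%N.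
  by move=> m Sm; rewrite ltnNge; apply/negP => gm; apply: far; exists m.
by rewrite !blend_far //; apply: TT'; lia.
Qed.

Lemma blend_shift a S T : sparse (9 * r) S ->
  blend (fun g => S (g + a)) (fun g => T (g + a)) = fun g => blend S T (g + a).
Proof.
move=> Ssp; apply/funext => g.
have Ssp' : sparse (9 * r) (fun g => S (g + a)).
  move=> h k Sh Sk hk; apply: (addIr a); apply: Ssp => //.
  by rewrite opprD addrACA subrr addr0.
have [[m [Sm zm]]|far] := pselect (exists m, S m /\
    (nrm (g + a - m) <= 4 * r)%N).
  rewrite (@blend_near S _ m) //; last by lia.
  rewrite (@blend_near _ _ (m - a)) ?subrK //; last first.
    by rewrite opprB addrA (leq_trans zm) ?leq_mul2r ?orbT.
  by rewrite /patch subrK opprB addrA.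
rewrite !blend_far // => m Sm; rewrite ltnNge; apply/negP => gm.
  by apply: far; exists m.
by apply: far; exists (m + a); split=> //; rewrite opprD addrACA subrr addr0.
Qed.

End Blend.

(** * Blending from coarse to fine scales *)

Section Tower.
Variable n : nat.
Hypothesis n0 : (0 < n)%N.
Implicit Types (S : nat -> 'rV[int]_n -> Prop) (T : 'rV[int]_n -> rat).
Implicit Types (g h m : 'rV[int]_n) (k K : nat).

(** The ratio [12] beats the factor [6] of [drift_blend]. The packing
    argument needs a multiple of [n]. *)
Definition radius k : nat := (20 * n * 12 ^ k)%N.

Lemma radius_gt0 k : (0 < radius k)%N.
Proof. by rewrite /radius !muln_gt0 n0 expn_gt0. Qed.

Lemma radiusS k : radius k.+1 = (12 * radius k)%N.
Proof. by rewrite /radius expnS mulnCA. Qed.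

Lemma radius_ge k : (k <= radius k)%N.
Proof. by elim: k => // k IH; rewrite radiusS; have := radius_gt0 k; lia. Qed.

(** The coarsest level is blended first. *)
Fixpoint tower S K T : 'rV[int]_n -> rat :=
  if K is k.+1 then tower S k (blend (radius k) (S k) T) else T.

Definition all_sparse S := forall k, sparse (9 * radius k) (S k).

(** With [b_k = 12 ^ - k / 2] the bound of [drift_blend] at level [k] reads
    [6 b_(k+1) + 5 / radius k <= b_k]: each summand is at most half of [b_k]. *)
Lemma drift_tower S K T : all_sparse S -> drift ((2 * 12 ^ K)%:R^-1) T ->
  drift 2%:R^-1 (tower S K T).
Proof.
move=> Ssp; elim: K T => [|K IH] T; first by rewrite expn0 muln1.
move=> dT /=; apply: IH => g i.
have := drift_blend (radius_gt0 K) _ (Ssp K) dT g i; rewrite invr_ge0 ler0n.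
move=> /(_ isT) /le_trans; apply; rewrite /radius expnS.
set P := (12 ^ K)%N.
have P0 : P%:R != 0 :> rat by rewrite pnatr_eq0 -lt0n expn_gt0.
have nn0 : n%:R != 0 :> rat by rewrite pnatr_eq0 -lt0n.
have -> : 6%:R * (2 * (12 * P))%:R^-1 + 5%:R / (20 * n * P)%:R
  = 4%:R^-1 * P%:R^-1 * (1 + n%:R^-1) :> rat.
  by rewrite !natrM; field; rewrite nn0 P0.
have -> : (2 * P)%:R^-1 = 4%:R^-1 * P%:R^-1 * 2%:R :> rat.
  by rewrite natrM; field.
apply: ler_wpM2l; first by rewrite mulr_ge0 ?invr_ge0 ?ler0n.
have : n%:R^-1 <= 1 :> rat by rewrite invf_le1 ?ler1n ?ltr0n.
lra.
Qed.

(** Level [k] costs [4 radius k], and these losses add up to less than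
    [radius K]. *)
Lemma agree_tower N y R S K T T' : all_sparse S ->
  agree N y (R + radius K) T T' -> agree N y R (tower S K T) (tower S K T').
Proof.
move=> Ssp; elim: K T T' => [|K IH] T T' TT' /=.
  by move=> z zy; apply: TT'; apply: leq_trans zy (leq_addr _ _).
apply: IH; apply: (agree_blend (radius_gt0 K) (Ssp K)) => z zy; apply: TT'.
by apply: leq_trans zy _; rewrite radiusS; lia.
Qed.

(** Blending at level [k] makes [T] linear, modulo [5], up to the distance
    [3 radius k] of [m]; the finer levels lose at most [radius k] of it. *)
Lemma tower_core S k K T m : all_sparse S -> (k < K)%N -> S k m ->
  exists N, agree N m (2 * radius k)
    (tower S K T) (tower S k (fun g => rise (g - m))).
Proof.
move=> Ssp kK Sm; rewrite -(subnKC kK).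
elim: (K - k.+1)%N T => [|d IH] T; last by rewrite addnS /=; apply: IH.
rewrite addn0 /=; exists (Num.floor (T m / 5%:R)).
apply: agree_tower => // z zm.
rewrite (@blend_near _ _ (radius_gt0 k) _ _ m) //; last by lia.
by rewrite /patch plateau1 ?radius_gt0 //; [ring | lia].
Qed.

Lemma tower_shift a S K T : all_sparse S ->
  tower (fun k g => S k (g + a)) K (fun g => T (g + a))
  = fun g => tower S K T (g + a).
Proof.
move=> Ssp; elim: K T => [|K IH] T //=.
by rewrite blend_shift ?radius_gt0 // IH.
Qed.

Definition mod5 (t : rat) : 'Z_5 := (Num.floor t)%:~R.

Lemma mod5D t N : mod5 (t + 5%:R * N%:~R) = mod5 t.
Proof.
have -> : 5%:R * N%:~R = (5%:Z * N)%:~R :> rat by rewrite intrM.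
rewrite /mod5 floorDrz ?intr_int // intrKfloor intrD intrM.
by rewrite (_ : 5%:Z%:~R = 0) ?mul0r ?addr0 //; apply/val_inj.
Qed.

Definition arc5 (a b : 'Z_5) : Prop := b = a + 1 \/ b = a + 2%:R.

(** An increment in [[1, 2]] moves the integer part by [1] or [2]. *)
Lemma mod5_arc t t' : `|t' - t - 3%:R / 2%:R| <= 2%:R^-1 ->
  arc5 (mod5 t) (mod5 t').
Proof.
rewrite ler_norml => tt'.
have [E|E] : Num.floor t' = Num.floor t + 1 \/ Num.floor t' = Num.floor t + 2.
  have := floor_le t; have := floorD1_gt t.
  set F := Num.floor t; rewrite intrD => F1 F2.
  have [t'F|t'F] := ltP t' (F%:~R + 2%:R); [left|right]; apply: floor_def.
    by rewrite !intrD; lra.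
  by rewrite !intrD; lra.
by left; rewrite /mod5 E intrD.
by right; rewrite /mod5 E intrD.
Qed.

(** The provisional colour of the origin, computed from [K] levels of
    markers [S]. *)
Definition stage S K : 'Z_5 := mod5 (tower S K (@rise n) 0).

Lemma stage_stable S k K m : all_sparse S -> (k < K)%N -> S k m ->
  (nrm m <= 2 * radius k)%N ->
  stage S K = mod5 (tower S k (fun g => rise (g - m)) 0).
Proof.
move=> Ssp kK Sm mk; have [N NE] := tower_core (@rise n) Ssp kK Sm.
by rewrite /stage NE ?mod5D // sub0r nrmN.
Qed.

(** Both colours are read off one and the same function, the tower of the
    levels below [k] over the linear function that starts at [m]. *)
Lemma stage_arc S k K K' m i : all_sparse S -> (k < K)%N -> (k < K')%N ->
  S k m -> (nrm m < 2 * radius k)%N ->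
  arc5 (stage S K) (stage (fun k g => S k (g + gen i)) K').
Proof.
move=> Ssp kK kK' Sm mk; rewrite (stage_stable Ssp kK Sm); last exact: ltnW.
have -> : stage (fun k g => S k (g + gen i)) K'
    = mod5 (tower S K' (fun g => rise (g - gen i)) (gen i)).
  rewrite /stage -[X in tower S K' _ X]add0r; congr mod5.
  rewrite -[RHS]/((fun g => tower S K' (fun g => rise (g - gen i))
    (g + gen i)) 0).
  rewrite -tower_shift //; congr (tower _ _ _ _).
  by apply/funext => g; rewrite addrK.
have [N NE] := tower_core (fun g => rise (g - gen i)) Ssp kK' Sm.
rewrite NE ?mod5D; last first.
  by apply: leq_trans (nrmD _ _) _; rewrite nrmN nrm_gen add1n.
apply: mod5_arc; rewrite -{1}(add0r (gen i)); apply: drift_tower => // g j.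
have -> : g + gen j - m = g - m + gen j by rewrite addrAC.
rewrite (riseD (g - m)) rise_gen [X in X - _ - _]addrC addrK subrr normr0.
by rewrite invr_ge0 ler0n.
Qed.

End Tower.

(** * Borel predicates on the free part *)

Section Borel.
Variable n : nat.
Implicit Types (g h : 'rV[int]_n) (x : free_part n) (P Q : free_part n -> Prop).

Definition act g x : free_part n :=
  SigSub (mem_set (@free_part_shift n g _ (set_valP x))).

Lemma val_act g x h : val (act g x) h = val x (h + g).
Proof. by []. Qed.

Lemma act0 x : act 0 x = x.
Proof. by apply/val_inj/funext => h; rewrite val_act addr0. Qed.

Lemma actD g h x : act g (act h x) = act (g + h) x.
Proof. by apply/val_inj/funext => k; rewrite !val_act addrA. Qed.

Lemma act_free g x : act g x = x -> g = 0.
Proof.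
move=> /(congr1 val) gx; apply/eqP/contraT => g0.
by case: (set_valP x g g0); exact: gx.
Qed.

(** Asking for all the translates at once makes the class stable under the
    action by definition, with no appeal to the continuity of the shift. *)
Definition orbit_borel P : Prop := forall g, borel_set [set x | P (act g x)].

Lemma eq_orbit_borel P Q :
  (forall x, P x <-> Q x) -> orbit_borel P -> orbit_borel Q.
Proof.
move=> PQ bP g; suff <- : [set x | P (act g x)] = [set x | Q (act g x)] by [].
by apply/seteqP; split=> x /=; rewrite PQ.
Qed.

Lemma orbit_borel_act h P : orbit_borel P -> orbit_borel (fun x => P (act h x)).
Proof.
move=> bP g; have := bP (h + g); congr borel_set.
by apply/seteqP; split=> x /=; rewrite actD.
Qed.

Lemma orbit_borel_not P : orbit_borel P -> orbit_borel (fun x => ~ P x).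
Proof. by move=> bP g; have := sigma_algebraCD (bP g); rewrite setTD. Qed.

Lemma orbit_borel_ex (I : countType) (P : I -> free_part n -> Prop) :
  (forall i, orbit_borel (P i)) -> orbit_borel (fun x => exists i, P i x).
Proof.
move=> bP g.
have -> : [set x | exists i, P i (act g x)] =
    \bigcup_k (if unpickle k is Some i then [set x | P i (act g x)] else set0).
  apply/seteqP; split=> x /=.
    by move=> [i Pi]; exists (pickle i) => //; rewrite pickleK.
  by move=> [k _]; case: unpickle => // i Pi; exists i.
apply: sigma_algebra_bigcup => k.
by case: unpickle => [i|]; [apply: bP | apply: sigma_algebra0].
Qed.

Lemma orbit_borel_all (I : countType) (P : I -> free_part n -> Prop) :
  (forall i, orbit_borel (P i)) -> orbit_borel (fun x => forall i, P i x).
Proof.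
move=> bP; apply: (@eq_orbit_borel (fun x => ~ exists i, ~ P i x)).
  move=> x; split=> [nP i|Pi [i]]; last by apply.
  by apply: contrapT => nPi; apply: nP; exists i.
by apply: orbit_borel_not; apply: orbit_borel_ex => i; apply: orbit_borel_not.
Qed.

Lemma orbit_borel_or P Q : orbit_borel P -> orbit_borel Q ->
  orbit_borel (fun x => P x \/ Q x).
Proof.
move=> bP bQ.
apply: (@eq_orbit_borel (fun x => exists b : bool, (if b then P else Q) x)).
  by move=> x; split=> [[[]]|[]]; [left|right|exists true|exists false].
by apply: orbit_borel_ex => -[].
Qed.

Lemma orbit_borel_and P Q : orbit_borel P -> orbit_borel Q ->
  orbit_borel (fun x => P x /\ Q x).
Proof.
move=> bP bQ.
apply: (@eq_orbit_borel (fun x => forall b : bool, (if b then P else Q) x)).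
  move=> x; split=> [PQ|[Px Qx] []] //.
  by split; [apply: (PQ true)|apply: (PQ false)].
by apply: orbit_borel_all => -[].
Qed.

Lemma orbit_borel_imp P Q : orbit_borel P -> orbit_borel Q ->
  orbit_borel (fun x => P x -> Q x).
Proof.
move=> bP bQ; apply: (@eq_orbit_borel (fun x => ~ P x \/ Q x)).
  move=> x; split=> [[]//|PQ].
  by have [Px|] := pselect (P x); [right; apply: PQ|left].
by apply: orbit_borel_or => //; apply: orbit_borel_not.
Qed.

Lemma orbit_borel_cst (A : Prop) : orbit_borel (fun=> A).
Proof.
move=> g; have [a|na] := pselect A.
  have -> : [set x : free_part n | A] = ~` set0.
    by rewrite setC0; apply/seteqP; split.
  by rewrite -setTD; apply: sigma_algebraCD; apply: sigma_algebra0.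
have -> : [set x : free_part n | A] = set0 by apply/seteqP; split=> x //=.
exact: sigma_algebra0.
Qed.

Lemma orbit_borel_coord h b : orbit_borel (fun x => val x h = b).
Proof.
move=> g; apply: sub_sigma_algebra.
have cont : continuous (fun x : free_part n => (set_val x : cube n) (h + g)).
  move=> x.
  apply: (continuous_comp (f := (set_val : free_part n -> cube n))
    (g := fun y : cube n => y (h + g))).
    exact: initial_continuous.
  exact: (@proj_continuous _ _ (h + g)).
apply: (@open_comp _ _ _ [set b]) => [x _|]; first exact: cont.
exact: discrete_open.
Qed.

End Borel.

(** * Borel markers *)

Section Marker.
Variable n : nat.
Implicit Types (g h : 'rV[int]_n) (x : free_part n) (D : free_part n -> Prop).

Lemma finite_ball r : exists s : seq 'rV[int]_n,
  forall g, (nrm g <= r)%N -> g \in s.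
Proof.
exists [seq \row_i ((c i : nat)%:Z - r%:Z) | c : {ffun 'I_n -> 'I_(2 * r).+1}].
move=> g gr; apply/mapP.
exists [ffun i => inord (absz (g 0 i + r%:Z))]; first by rewrite mem_enum.
apply/rowP => i; rewrite mxE ffunE.
have : (`|g 0%R i| <= r)%N.
  by apply: leq_trans gr; rewrite /nrm (bigD1 i) //= leq_addr.
by move: (g 0 i) => z zr; rewrite inordK; lia.
Qed.

Definition pattern := seq ('rV[int]_n * bool).

Definition fits (p : pattern) (y : cube n) : Prop :=
  forall h b, (h, b) \in p -> y h = b.

Lemma orbit_borel_fits p : orbit_borel (fun x => fits p (val x)).
Proof.
apply: orbit_borel_all => h; apply: orbit_borel_all => b.
by apply: orbit_borel_imp; [apply: orbit_borel_cst | apply: orbit_borel_coord].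
Qed.

(** For each nonzero [g] of the ball, freeness gives a coordinate where [x] and
    [g x] differ; the pattern records the values of [x] at these coordinates. *)
Lemma separating_pattern r x : exists p : pattern, fits p (val x) /\
  forall g, (nrm g <= r)%N -> fits p (val (act g x)) -> g = 0.
Proof.
have [s sP] := finite_ball r.
have /choice[w wP] : forall g, exists h, g <> 0 -> val x (h + g) <> val x h.
  move=> g; have [->|g0] := eqVneq g 0; first by exists 0.
  apply: contrapT => /forallNP H; case/eqP: g0; apply: (@act_free n g x).
  apply/val_inj/funext => h; have := H h; rewrite val_act.
  by move=> /existsNP[_ /contrapT].
exists [seq (w g, val x (w g)) | g <- s]; split.
  by move=> h b /mapP[g _ [-> ->]].
move=> g gr fg; apply: contrapT => g0; apply: (wP g g0).
by rewrite -val_act; apply: fg; apply/mapP; exists g; rewrite ?sP.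
Qed.

(** The default value only makes the enumeration total. *)
Definition pattern_nat k : pattern := odflt [::] (unpickle k).

(** At step [k] all the points of [D] that the [k]-th pattern fits and
    separates from their near translates, and that have no earlier point nearby,
    are added. Two points added at the same step are never close, because the
    pattern fits both. *)
Fixpoint greedy r D k x : Prop :=
  if k is k'.+1 then
    greedy r D k' x \/
    (D x /\ fits (pattern_nat k') (val x) /\
     (forall g, (nrm g <= r)%N ->
        fits (pattern_nat k') (val (act g x)) -> g = 0) /\
     ~ exists g, (nrm g <= r)%N /\ greedy r D k' (act g x))
  else False.

Definition marker r D x : Prop := exists k, greedy r D k x.

Lemma orbit_borel_greedy r D k : orbit_borel D -> orbit_borel (greedy r D k).
Proof.
move=> bD; elim: k => [|k IH] /=; first exact: orbit_borel_cst.
apply: orbit_borel_or => //.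
apply: orbit_borel_and => //; apply: orbit_borel_and;
  first exact: orbit_borel_fits.
apply: orbit_borel_and.
  apply: orbit_borel_all => g; apply: orbit_borel_imp;
    first exact: orbit_borel_cst.
  apply: orbit_borel_imp; last exact: orbit_borel_cst.
  by apply: (@orbit_borel_act _ g (fun x => fits (pattern_nat k) (val x)));
    apply: orbit_borel_fits.
apply: orbit_borel_not; apply: orbit_borel_ex => g.
by apply: orbit_borel_and; [apply: orbit_borel_cst | apply: orbit_borel_act].
Qed.

Lemma orbit_borel_marker r D : orbit_borel D -> orbit_borel (marker r D).
Proof. by move=> bD; apply: orbit_borel_ex => k; apply: orbit_borel_greedy. Qed.

Lemma greedy_mono r D k k' x : (k <= k')%N -> greedy r D k x -> greedy r D k' x.
Proof.
move=> /subnKC <-; elim: (k' - k)%N => [|d IH]; first by rewrite addn0.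
by rewrite addnS /=; left; apply: IH.
Qed.

Lemma marker_sub r D x : marker r D x -> D x.
Proof. by case=> k; elim: k => [|k IH] /= => [[]|[/IH|[]]]. Qed.

(** If one of the two points came later, the earlier one forbade it; if they
    came together, the pattern of that step separates them. *)
Lemma marker_sparse r D x g : (nrm g <= r)%N ->
  marker r D x -> marker r D (act g x) -> g = 0.
Proof.
move=> gr [k kx] [k' kgx].
have {kx} := greedy_mono (leq_maxl k k') kx.
have {kgx} := greedy_mono (leq_maxr k k') kgx.
elim: (maxn k k') => [[]|{k k'}k IH] /=.
move=> [kgx|[_ [f2 [_ n2]]]] [kx|[_ [_ [s1 n1]]]].
- exact: IH.
- by case: n1; exists g.
- by case: n2; exists (- g); rewrite nrmN actD addNr act0.
- exact: s1.
Qed.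

Lemma marker_max r D x : D x ->
  exists g, (nrm g <= r)%N /\ marker r D (act g x).
Proof.
move=> Dx; have [p [px ps]] := separating_pattern r x.
have [[g [gr kg]]|nk] := pselect (exists g, (nrm g <= r)%N
    /\ greedy r D (pickle p) (act g x)).
  by exists g; split=> //; exists (pickle p).
exists 0; rewrite nrm0 act0; split=> //; exists (pickle p).+1; right.
by rewrite /pattern_nat pickleK.
Qed.

End Marker.

(** * Layers of markers and the choice of one layer per orbit *)

Section Layers.
Variable n : nat.
Hypothesis n0 : (0 < n)%N.
Implicit Types (g h : 'rV[int]_n) (x : free_part n) (r : nat).

Definition away r (D : free_part n -> Prop) x : Prop :=
  ~ exists h, (nrm h <= r)%N /\ D (act h x).

Fixpoint earlier r i x : Prop :=
  if i is j.+1 then earlier r j x \/ marker (9 * r) (away r (earlier r j)) x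
  else False.

Definition layer r i : free_part n -> Prop :=
  marker (9 * r) (away r (earlier r i)).

Lemma earlier_layer r i j x : (j < i)%N -> layer r j x -> earlier r i x.
Proof.
move=> /subnKC <- jx.
elim: (i - j.+1)%N => [|d IH]; last by rewrite addnS; left.
by rewrite addn0; right.
Qed.

Lemma orbit_borel_layer r i : orbit_borel (layer r i).
Proof.
have away_b D : orbit_borel D -> orbit_borel (away r D).
  move=> bD; apply: orbit_borel_not; apply: orbit_borel_ex => h.
  by apply: orbit_borel_and; [apply: orbit_borel_cst | apply: orbit_borel_act].
apply: orbit_borel_marker; apply: (away_b).
elim: i => [|i IH] /=; first exact: orbit_borel_cst.
by apply: orbit_borel_or => //; apply: orbit_borel_marker; apply: away_b.
Qed.

Definition box_count : nat := #|{ffun 'I_n -> 'I_(18 * n).+1}|.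

(** Cut the ball into cubes of side [t], of which there are [box_count] at
    most: two points of one cube differ by less than [t] in each of the [n]
    coordinates. *)
Lemma packing t (h : 'I_box_count.+1 -> 'rV[int]_n) : (0 < t)%N ->
  (forall i, nrm (h i) <= 9 * (n * t))%N ->
  exists i j : 'I_box_count.+1, (i < j)%N /\ (nrm (h i - h j) <= n * t)%N.
Proof.
move=> t0 hb.
pose c i : {ffun 'I_n -> 'I_(18 * n).+1} :=
  [ffun a => inord (absz (h i 0 a + (9 * (n * t))%N%:Z)%R %/ t)].
have cE i a : (c i a : nat) = (absz (h i 0 a + (9 * (n * t))%N%:Z)%R %/ t)%N.
  rewrite ffunE inordK // ltnS -ltnS ltn_divLR //.
  have : (`|h i 0%R a| <= 9 * (n * t))%N.
    by apply: leq_trans (hb i); rewrite /nrm (bigD1 a) //= leq_addr.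
  by move: (h i 0 a) => z; nia.
have close i j : c i = c j -> (nrm (h i - h j) <= n * t)%N.
  move=> cij; have -> : (n * t = \sum_(a < n) t)%N.
    by rewrite sum_nat_const card_ord.
  apply: leq_sum => a _; rewrite !mxE.
  have : (c i a = c j a :> nat) by rewrite cij.
  rewrite !cE.
  have : (`|h i 0%R a| <= 9 * (n * t))%N.
    by apply: leq_trans (hb i); rewrite /nrm (bigD1 a) //= leq_addr.
  have : (`|h j 0%R a| <= 9 * (n * t))%N.
    by apply: leq_trans (hb j); rewrite /nrm (bigD1 a) //= leq_addr.
  move: (h i 0 a) (h j 0 a) (9 * (n * t))%N => u v B vB uB.
  have := divn_eq (absz (u + B%:Z)) t; have := ltn_pmod (absz (u + B%:Z)) t0.
  have := divn_eq (absz (v + B%:Z)) t; have := ltn_pmod (absz (v + B%:Z)) t0.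
  by move: (_ %% _)%N (_ %% _)%N (_ %/ _)%N (_ %/ _)%N => ????; nia.
have /injectivePn[i [j ij cij]] : ~~ injectiveb c.
  by apply/injectiveP => /leq_card; rewrite card_ord ltnn.
have [lt|lt|e] := ltngtP i j.
- by exists i, j; split=> //; apply: close.
- by exists j, i; split=> //; apply: close.
- by case/eqP: ij; apply: val_inj.
Qed.

(** If [x] is far from the first [box_count.+1] layers, then each of these
    layers, being maximal, has a point within [9 r] of [x]. Points of different
    layers are more than [r] apart, against the packing bound. *)
Lemma layers_cover r t x : (0 < t)%N -> r = (n * t)%N ->
  exists i h, [/\ (i < box_count.+1)%N, (nrm h <= r)%N & layer r i (act h x)].
Proof.
move=> t0 rt; apply: contrapT => no.
have /choice[h hP] : forall i : 'I_box_count.+1, exists h,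
    (nrm h <= 9 * r)%N /\ layer r i (act h x).
  move=> i; apply: marker_max => -[h [hr he]]; apply: no.
  suff [j [ji jh]] : exists j, (j < i)%N /\ layer r j (act h x).
    by exists j, h; split=> //; apply: ltn_trans ji _.
  elim: (nat_of_ord i) he => [//|k IH] /= [/IH[j [jk ?]]|kx].
    by exists j; split=> //; apply: ltnW.
  by exists k.
have hb i : (nrm (h i) <= 9 * (n * t))%N by rewrite -rt; case: (hP i).
have [i [j [ij hij]]] := packing t0 hb.
have [_ /marker_sub] := hP j; apply; exists (h i - h j); rewrite rt; split=> //.
by rewrite actD subrK; apply: earlier_layer ij _; rewrite -rt; case: (hP i).
Qed.

(** The constant [d] makes this invariant under the action. It is harmless:
    [radius n j] exceeds it for large [j]. *)
Definition recurrent i x : Prop := exists d, forall J, exists j, (J <= j)%N /\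
  exists h, (nrm h <= radius n j + d)%N /\ layer (radius n j) i (act h x).

Lemma recurrent_act i g x : recurrent i x -> recurrent i (act g x).
Proof.
move=> [d dx]; exists (d + nrm g)%N => J; have [j [Jj [h [hj lx]]]] := dx J.
exists j; split=> //; exists (h - g); rewrite actD subrK; split=> //.
by apply: leq_trans (nrmD _ _) _; rewrite nrmN addnA leq_add2r.
Qed.

Lemma recurrent_actE i g x : recurrent i (act g x) <-> recurrent i x.
Proof.
split; last exact: recurrent_act.
by move=> /(@recurrent_act i (- g)); rewrite actD addNr act0.
Qed.

Lemma recurrent_ex x : exists i, recurrent i x.
Proof.
apply: contrapT => /forallNP no.
have /choice[J JP] : forall i, exists J, forall j, (J <= j)%N ->
    ~ exists h, (nrm h <= radius n j)%N /\ layer (radius n j) i (act h x).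
  move=> i; apply: contrapT => /forallNP nJ; apply: (no i); exists 0%N => J.
  have /existsNP[j /not_implyP[Jj /contrapT jh]] := nJ J.
  by exists j; rewrite addn0.
(* a level beyond which none of the first box_count.+1 layers comes near x *)
pose j := (\max_(i < box_count.+1) J i)%N.
have t0 : (0 < 20 * 12 ^ j)%N by rewrite muln_gt0 expn_gt0.
have [|i [h [iC hr lx]]] := @layers_cover (radius n j) _ x t0.
  by rewrite /radius mulnCA mulnA.
apply: (JP i j); last by exists h.
exact: (leq_bigmax (Ordinal iC) (F := fun i : 'I__ => J i)).
Qed.

Definition first_recurrent i x : Prop :=
  recurrent i x /\ forall i', (i' < i)%N -> ~ recurrent i' x.

(** Restricting each orbit to its least recurrent index makes the level sparse
    while it still comes near every point, at infinitely many levels. *)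
Definition level j x : Prop :=
  exists i, first_recurrent i x /\ layer (radius n j) i x.

Lemma orbit_borel_level j : orbit_borel (level j).
Proof.
have recurrent_b i : orbit_borel (recurrent i).
  apply: orbit_borel_ex => d; apply: orbit_borel_all => J;
    apply: orbit_borel_ex => j'.
  apply: orbit_borel_and; first exact: orbit_borel_cst.
  apply: orbit_borel_ex => h; apply: orbit_borel_and;
    first exact: orbit_borel_cst.
  by apply: orbit_borel_act; apply: orbit_borel_layer.
apply: orbit_borel_ex => i; apply: orbit_borel_and;
  last exact: orbit_borel_layer.
apply: orbit_borel_and => //; apply: orbit_borel_all => i'.
by apply: orbit_borel_imp; [apply: orbit_borel_cst | apply: orbit_borel_not].
Qed.

(** The markers of level [j] in the coordinates of the orbit whose origin is
    [x]. *)
Definition seen x j g : Prop := level j (act g x).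

Lemma seen_act g x : seen (act g x) = fun j h => seen x j (h + g).
Proof. by apply/funext => j; apply/funext => h; rewrite /seen actD. Qed.

Lemma seen_sparse x : all_sparse (seen x).
Proof.
move=> j g h [i [[oi mi] li]] [i' [[oi' mi'] li']] gh.
have ii' : i = i'.
  have [lt|lt|//] := ltngtP i i'.
    by case: (mi' i) => //; move: oi; rewrite !recurrent_actE.
  by case: (mi i') => //; move: oi'; rewrite !recurrent_actE.
rewrite -ii' in li'; apply/eqP; rewrite -subr_eq0; apply/eqP.
by apply: (marker_sparse gh li'); rewrite actD subrK.
Qed.

(** The strict bound leaves room for the neighbours of [x]. *)
Definition settled k x : Prop :=
  exists g, (nrm g < 2 * radius n k)%N /\ seen x k g.

Lemma settled_ex x : exists k, settled k x.
Proof.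
have [i oi] : exists i, first_recurrent i x.
  have [i oi] := recurrent_ex x.
  have ex : exists i, `[< recurrent i x >] by exists i; apply/asboolP.
  exists (ex_minn ex); case: ex_minnP => m /asboolP om mm; split=> // i' lt oi'.
  by have := mm i'; rewrite leqNgt lt; case/(_ _)/notF; apply/asboolP.
have [[d dx] mi] := oi; have [k [dk [h [hk lx]]]] := dx d.+1.
exists k, h; split; first by have := radius_ge n0 k; lia.
exists i; split=> //; split; first by apply/recurrent_actE; exists d.
by move=> i' /mi no; rewrite recurrent_actE.
Qed.

(** The eventual value of [stage (seen x) K]; by [stage_settled] the set has
    exactly one element. *)
Definition colour x : 'Z_5 :=
  xget 0 [set c | exists k, settled k x /\ stage (seen x) k.+1 = c].

Lemma stage_settled k K K' x : settled k x -> (k < K)%N -> (k < K')%N ->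
  stage (seen x) K = stage (seen x) K'.
Proof.
move=> [g [gk gx]] kK kK'; have sp := seen_sparse (x := x).
by rewrite !(stage_stable n0 sp _ gx) // ltnW.
Qed.

Lemma colourE k K x : settled k x -> (k < K)%N -> colour x = stage (seen x) K.
Proof.
move=> kx kK; rewrite /colour; case: xgetP => [_ _ [k' [k'x <-]]|no];
  last first.
  by case: (no (stage (seen x) k.+1)); exists k.
rewrite (stage_settled k'x (ltnSn k') (leq_maxl k'.+1 K)).
by apply: (stage_settled kx) => //; apply: leq_trans kK (leq_maxr _ _).
Qed.

(** Values of a tower are computed from countably many Borel data, and the
    rationals are countable. The induction blends a function that depends on
    [x] as well, hence the general statement [H]. *)
Lemma orbit_borel_tower (T : 'rV[int]_n -> rat) K g v :
  orbit_borel (fun x => tower (seen x) K T g = v).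
Proof.
pose bfun (F : free_part n -> 'rV[int]_n -> rat) :=
  forall g v, orbit_borel (fun x => F x g = v).
suff H : forall F, bfun F -> bfun (fun x => tower (seen x) K (F x)).
  by apply: (H (fun=> T)) => h u; apply: orbit_borel_cst.
elim: K {g v} => [|K IH] F bF //=; apply: IH => g v.
have bsee m : orbit_borel (fun x => seen x K m /\
      (nrm (g - m) <= 4 * radius n K)%N).
  apply: orbit_borel_and; last exact: orbit_borel_cst.
  by apply: orbit_borel_act; apply: orbit_borel_level.
apply: (@eq_orbit_borel _ (fun x =>
    (exists m, (seen x K m /\ (nrm (g - m) <= 4 * radius n K)%N) /\
       patch (radius n K) (F x) m g = v) \/
    (~ (exists m, seen x K m /\ (nrm (g - m) <= 4 * radius n K)%N) /\
       F x g = v))).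
  move=> x; have sp : sparse (9 * radius n K) (seen x K) by apply: seen_sparse.
  have r0 := radius_gt0 n0 K.
  have [[m [mx gm]]|no] := pselect (exists m, seen x K m /\
      (nrm (g - m) <= 4 * radius n K)%N).
    rewrite (blend_near r0 _ sp mx); last by lia.
    split=> [[[m' [[m'x gm'] <-]]|[]//]|Ev]; last by left; exists m.
      congr (patch _ _ _ _); apply: sp => //.
      apply: leq_trans (nrm_triangle g _ _) _.
      by rewrite nrmB; lia.
    by case; exists m.
  rewrite blend_far; last first.
    by move=> m mx; rewrite ltnNge; apply/negP => gm; apply: no; exists m.
  by split=> [[[m [mx _]]|[]//]|]; [case: no; exists m | right].
apply: orbit_borel_or; last first.
  apply: orbit_borel_and => //.
  by apply: orbit_borel_not; apply: orbit_borel_ex.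
apply: orbit_borel_ex => m; apply: orbit_borel_and => //.
apply: (@eq_orbit_borel _ (fun x => exists u w, F x g = u /\ F x m = w /\
   u + plateau (radius n K) (nrm (g - m))
    * (rise (g - m) + 5%:R * (Num.floor (w / 5%:R))%:~R - u) = v)).
  move=> x; split=> [[u [w [<- [<- <-]]]] //|<-].
  by exists (F x g), (F x m).
apply: orbit_borel_ex => u; apply: orbit_borel_ex => w;
  apply: orbit_borel_and => //.
by apply: orbit_borel_and => //; apply: orbit_borel_cst.
Qed.

Lemma orbit_borel_colour c : orbit_borel (fun x => colour x = c).
Proof.
apply: (@eq_orbit_borel _ (fun x => exists k, settled k x /\
    exists v, tower (seen x) k.+1 (@rise n) 0 = v /\ mod5 v = c)).
  move=> x; split=> [[k [kx [v [vE <-]]]]|<-].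
    by rewrite (colourE kx (ltnSn k)) /stage vE.
  have [k kx] := settled_ex x; exists k; split=> //.
  by exists (tower (seen x) k.+1 (@rise n) 0); rewrite (colourE kx (ltnSn k)).
apply: orbit_borel_ex => k; apply: orbit_borel_and.
  apply: orbit_borel_ex => g; apply: orbit_borel_and;
    first exact: orbit_borel_cst.
  by apply: orbit_borel_act; apply: orbit_borel_level.
apply: orbit_borel_ex => v; apply: orbit_borel_and;
  first exact: orbit_borel_tower.
exact: orbit_borel_cst.
Qed.

Lemma colour_arc i x : arc5 (colour x) (colour (act (gen i) x)).
Proof.
have [k kx] := settled_ex x; have [k' k'x] := settled_ex (act (gen i) x).
rewrite (colourE kx (leq_maxl k.+1 k'.+1)) (colourE k'x (leq_maxr k.+1 k'.+1)).
rewrite seen_act; have [g [gk gx]] := kx.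
apply: (stage_arc n0 i (seen_sparse (x := x)) _ _ gx gk); exact: leq_maxl.
Qed.

End Layers.



(** * Baire category in the space of configurations *)

Lemma nrm_mulrn n (g : 'rV[int]_n) k : g != 0 -> (k <= nrm (g *+ k))%N.
Proof.
move=> g0; have [i gi] : exists i, g 0 i != 0.
  apply: contrapT => /forallNP gz; case/eqP: g0; apply/rowP => i.
  by rewrite mxE; apply/eqP; rewrite -[_ == _]negbK; apply/negP/gz.
rewrite /nrm (bigD1 i) //=; apply: leq_trans (leq_addr _ _).
by rewrite mulmxnE; move: (g 0 i) gi => u u0; nia.
Qed.

Lemma pattern_bound n (p : pattern n) :
  exists M : nat, forall h b, (h, b) \in p -> (nrm h < M)%N.
Proof.
exists (\sum_(hb <- p) (nrm hb.1).+1)%N => h b hb.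
by rewrite (big_rem _ hb) /= leq_addr.
Qed.

Section Category.
Variable n : nat.
Implicit Types (g h : 'rV[int]_n) (y z : cube n) (p q : pattern n).

Definition consistent p : Prop := exists y, fits p y.

Lemma fits_cat p q y : fits (q ++ p) y <-> fits q y /\ fits p y.
Proof.
split=> [f|[fq fp] h b]; last by rewrite mem_cat => /orP[/fq|/fp].
by split=> h b hb; apply: f; rewrite mem_cat hb ?orbT.
Qed.

(** This says that [U] contains a dense open set. *)
Definition generic (U : set (cube n)) : Prop := forall p, consistent p ->
  exists q, consistent (q ++ p) /\ forall y, fits (q ++ p) y -> U y.

Definition meagre (A : set (cube n)) : Prop :=
  exists U : nat -> set (cube n),
    (forall i, generic (U i)) /\ forall y, A y -> exists i, ~ U i y.

(** The Baire category theorem: a chain of longer and longer patterns enters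
    the sets [U i] one after the other, and any point that extends all of them
    works. *)
Lemma baire A p : meagre A -> consistent p -> exists y, fits p y /\ ~ A y.
Proof.
move=> [U [Ufat AU]] p0.
have /choice[ext extP] : forall ip : nat * pattern n, exists q,
    consistent ip.2 -> consistent (q ++ ip.2) /\
    forall y, fits (q ++ ip.2) y -> U ip.1 y.
  move=> [i r]; have [r0|nr] := pselect (consistent r); last by exists [::].
  by have [q qP] := Ufat i r r0; exists q.
pose P := fix P i := if i is j.+1 then ext (j, P j) ++ P j else p.
have Pc i : consistent (P i).
  by elim: i => [//|i IH] /=; have [] := extP (i, P i) IH.
have Pm i j hb : (i <= j)%N -> hb \in P i -> hb \in P j.
  move=> /subnKC <- hi; elim: (j - i)%N => [|d IH]; first by rewrite addn0.
  by rewrite addnS /= mem_cat IH orbT.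
pose y : cube n := fun h => `[< exists i, (h, true) \in P i >].
have Py i : fits (P i) y.
  move=> h [] hi; first by apply/asboolP; exists i.
  apply/asboolP => -[j hj]; have [z zP] := Pc (maxn i j).
  have := zP _ _ (Pm _ _ _ (leq_maxl i j) hi).
  by rewrite (zP _ _ (Pm _ _ _ (leq_maxr i j) hj)).
exists y; split; first exact: (Py 0%N).
move=> /AU[i]; apply; have [_] := extP (i, P i) (Pc i).
by apply; apply: (Py i.+1).
Qed.

Lemma genericT : generic setT.
Proof. by move=> p pc; exists [::]. Qed.

Lemma meagre_sub A B : A `<=` B -> meagre B -> meagre A.
Proof. by move=> AB [U [Uf BU]]; exists U; split=> // y /AB/BU. Qed.

Lemma meagre_genericC U : generic U -> meagre (~` U).
Proof. by move=> Uf; exists (fun=> U); split=> // y ?; exists 0%N. Qed.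

Lemma meagre_ex (I : countType) (A : I -> set (cube n)) :
  (forall i, meagre (A i)) -> meagre [set y | exists i, A i y].
Proof.
move=> /choice[U UP].
exists (fun k => if unpickle k is Some (i, j) then U i j else setT); split.
  move=> k; case: unpickle => [[i j]|]; last exact: genericT.
  by have [] := UP i.
move=> y [i Ai]; have [_ /(_ y Ai)[j Uj]] := UP i.
by exists (pickle (i, j)); rewrite pickleK.
Qed.

Lemma meagreU A B : meagre A -> meagre B -> meagre (A `|` B).
Proof.
move=> Am Bm.
apply: (@meagre_sub _ [set y | exists b : bool, (if b then A else B) y]).
  by move=> y [Ay|By]; [exists true|exists false].
by apply: meagre_ex => -[].
Qed.

Definition shift_pattern g p : pattern n := [seq (hb.1 - g, hb.2) | hb <- p].

Lemma fits_shift g p y : fits (shift_pattern g p) (shift g y) <-> fits p y.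
Proof.
split=> f h b hb.
  rewrite -(f (h - g) b) /shift ?subrK //.
  by apply/mapP; exists (h, b).
by case/mapP: hb => -[k c] kc [-> ->]; rewrite /shift subrK; apply: f.
Qed.

Lemma shiftNK g y : shift g (shift (- g) y) = y.
Proof. by rewrite shiftD subrr; apply/funext => h; rewrite /shift addr0. Qed.

Lemma shiftKN g y : shift (- g) (shift g y) = y.
Proof. by rewrite shiftD addNr; apply/funext => h; rewrite /shift addr0. Qed.

Lemma meagre_shift g A : meagre A -> meagre [set y | A (shift g y)].
Proof.
move=> [U [Uf AU]]; exists (fun i => [set y | U i (shift g y)]).
split=> [i p [y py]|y /AU //].
have [|q [[z zq] qU]] := Uf i (shift_pattern g p).
  by exists (shift g y); apply/fits_shift.
have qE : forall w, fits (shift_pattern (- g) q ++ p) w <->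
    fits (q ++ shift_pattern g p) (shift g w).
  move=> w; rewrite !fits_cat fits_shift.
  by rewrite -{1}(shiftKN g w) fits_shift.
exists (shift_pattern (- g) q); split; last by move=> w /qE/qU.
by exists (shift (- g) z); apply/qE; rewrite shiftNK.
Qed.

Definition cyl p : set (cube n) := [set y | fits p y].

(** A locally meagre set is meagre: the cylinders on which [A] is meagre are
    countably many and cover [cyl p] up to a nowhere dense set. *)
Lemma meagre_local p A :
  (forall q, consistent (q ++ p) ->
     exists q', consistent (q' ++ q ++ p) /\
       meagre (cyl (q' ++ q ++ p) `&` A)) ->
  meagre (cyl p `&` A).
Proof.
move=> loc; pose small q := meagre (cyl q `&` A).
pose U := [set y | fits p y -> exists q, small q /\ fits q y].
have Uf : generic U.
  move=> r [y yr].
  have [/loc[q' [[z zq] qs]]|nc] := pselect (consistent (r ++ p)); last first.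
    exists [::]; split=> [|w wr wp]; first by exists y.
    by case: nc; exists w; apply/fits_cat.
  have eqz w : fits ((q' ++ r ++ p) ++ r) w <-> fits (q' ++ r ++ p) w.
    by rewrite !fits_cat; tauto.
  exists (q' ++ r ++ p); split; first by exists z; apply/eqz.
  by move=> w /eqz wq _; exists (q' ++ r ++ p).
pose B q := if `[< small q >] then cyl q `&` A else set0.
apply: (@meagre_sub _ (~` U `|` [set y | exists q, B q y])).
  move=> y [yp Ay]; have [/(_ yp)[q [qs qy]]|nU] := pselect (U y); last by left.
  by right; exists q; rewrite /B (asboolT qs).
apply: meagreU; first exact: meagre_genericC.
apply: meagre_ex => q; rewrite /B; case: asboolP => // _.
by exists (fun=> setT); split=> // _; apply: genericT.
Qed.

Lemma nonfree_meagre : meagre (~` free_part n).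
Proof.
pose A g := [set y : cube n | g != 0 /\ shift g y = y].
apply: (@meagre_sub _ [set y | exists g, A g y]).
  by move=> y /existsNP[g /not_implyP[g0 /contrapT]]; exists g.
apply: meagre_ex => g; have [->|g0] := eqVneq g 0.
  by exists (fun=> setT); split=> [_|y []]; [apply: genericT | rewrite eqxx].
apply: (@meagre_sub _ (~` [set y | shift g y <> y])).
  by move=> y [_ ?] /=.
apply: meagre_genericC => p [y py].
have [M MP] := pattern_bound p.
have [h [hM hgM]] : exists h : 'rV[int]_n,
    (M <= nrm h)%N /\ (M <= nrm (h + g))%N.
  exists (g *+ M); rewrite -mulrSr; split; first exact: nrm_mulrn.
  by apply: leq_trans (nrm_mulrn _ g0).
(* Prescribe different values at h and h + g, out of reach of p. *)
exists [:: (h, true); (h + g, false)]; split; last first.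
  move=> z /fits_cat[fz _] /(congr1 (@^~ h)).
  by rewrite /shift (fz h true) ?inE ?eqxx ?(fz (h + g) false) ?inE ?eqxx ?orbT.
exists (fun k => if k == h then true else if k == h + g then false else y k).
apply/fits_cat; split=> k b.
  rewrite !inE => /orP[/eqP[-> ->]|/eqP[-> ->]]; rewrite ?eqxx //.
  by rewrite -subr_eq0 addrAC subrr add0r (negbTE g0).
move=> kb; have kM := MP _ _ kb.
have [kh|_] := eqVneq k h; first by move: kM; rewrite kh; lia.
have [kh|_] := eqVneq k (h + g); first by move: kM; rewrite kh; lia.
exact: py.
Qed.

(** Meagreness in the free part, which is comeagre by [nonfree_meagre]. *)
Definition thin (A : set (free_part n)) : Prop := meagre (val @` A).

Definition fcyl p : set (free_part n) := [set x | fits p (val x)].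

Lemma thin_sub A B : A `<=` B -> thin B -> thin A.
Proof. by move=> AB; apply: meagre_sub; apply: image_subset. Qed.

Lemma thinU A B : thin A -> thin B -> thin (A `|` B).
Proof. by move=> At Bt; rewrite /thin image_setU; apply: meagreU. Qed.

Lemma thin_ex (I : countType) (A : I -> set (free_part n)) :
  (forall i, thin (A i)) -> thin [set x | exists i, A i x].
Proof.
move=> /meagre_ex; apply: meagre_sub => _ [x [i Aix] <-].
by exists i, x.
Qed.

Lemma thin_act g A : thin A -> thin [set x | A (act g x)].
Proof.
move=> /(@meagre_shift g); apply: meagre_sub => _ [x Ax <-].
by exists (act g x).
Qed.

Lemma thin_genericC U : generic U -> thin [set x | ~ U (val x)].
Proof. by move=> /meagre_genericC; apply: meagre_sub => _ [x Ux <-]. Qed.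

Lemma thin_local p A :
  (forall q, consistent (q ++ p) ->
     exists q', consistent (q' ++ q ++ p) /\
       thin (fcyl (q' ++ q ++ p) `&` A)) ->
  thin (fcyl p `&` A).
Proof.
move=> loc; apply: (@meagre_sub _ (cyl p `&` (val @` A))).
  by move=> _ [x [xp Ax] <-]; split=> //; exists x.
apply: meagre_local => q /loc[q' [qc qt]]; exists q'; split=> //.
apply: meagre_sub qt => y [yq [x Ax xy]]; exists x => //; split=> //.
by rewrite /fcyl /= xy.
Qed.

Lemma baire_free A p : thin A -> consistent p -> exists x, fcyl p x /\ ~ A x.
Proof.
move=> At pc; have [y [yp yn]] := baire (meagreU At nonfree_meagre) pc.
have Fy : free_part n y by apply: contrapT => Fy; apply: yn; right.
exists (SigSub (mem_set Fy)); split=> // Ay; apply: yn; left.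
by exists (SigSub (mem_set Fy)).
Qed.

(** Below each cylinder there is one on which [A] is meagre or comeagre: a
    form of the Baire property suited to an induction over Borel sets. *)
Definition decided (A : set (free_part n)) : Prop := forall p, consistent p ->
  exists q, consistent (q ++ p) /\
    (thin (fcyl (q ++ p) `&` A) \/ thin (fcyl (q ++ p) `&` ~` A)).

Lemma thin0 : thin set0.
Proof.
by exists (fun=> setT); split=> [_|y [] //]; apply: genericT.
Qed.

Lemma decidedC A : decided A -> decided (~` A).
Proof.
move=> dA p /dA[q [qc h]]; exists q; split=> //; rewrite setCK.
by case: h; [right|left].
Qed.

(** Either some [A i] is comeagre on a smaller cylinder, and then so is the
    union; or every [A i] is locally meagre, hence meagre, on this one. *)
Lemma decided_bigcup (A : nat -> set (free_part n)) :
  (forall i, decided (A i)) -> decided (\bigcup_i A i).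
Proof.
move=> dA p pc.
have [[i [q [qc qt]]]|no] := pselect (exists i q, consistent (q ++ p) /\
    thin (fcyl (q ++ p) `&` ~` A i)).
  exists q; split=> //; right; apply: thin_sub qt => x [xq nx].
  by split=> // Ax; apply: nx; exists i.
exists [::]; split=> //; left.
apply: (@thin_sub _ [set x | exists i, (fcyl p `&` A i) x]).
  by move=> x [xp [i _ Ai]]; exists i.
apply: thin_ex => i; apply: thin_local => q qc.
have [q' [qc' [qt|qt]]] := dA i _ qc; first by exists q'.
by case: no; exists i, (q' ++ q); rewrite -catA.
Qed.

(** The filter generated by the cylinders around [x] converges to [x]
    coordinatewise, hence in the product topology. *)
Lemma open_pattern (A : set (free_part n)) x : open A -> A x ->
  exists p, fits p (val x) /\ fcyl p `<=` A.
Proof.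
move=> [B oB <-] Bx; set y := val x.
suff [p [py pB]] : exists p, fits p y /\ cyl p `<=` B.
  by exists p; split=> // z zp; apply: pB.
pose F : set_system (cube n) := [set D | exists p, fits p y /\ cyl p `<=` D].
have FF : Filter F.
  split; first by exists [::].
    move=> D E [p [py pD]] [q [qy qE]]; exists (p ++ q).
    by split; [apply/fits_cat | move=> z /fits_cat[/pD ? /qE ?]].
  by move=> D E DE [p [py pD]]; exists p; split=> // z /pD /DE.
suff cv : F --> (y : cube n) by apply: cv; apply: open_nbhs_nbhs.
apply/cvg_sup => h D [E [oE Ey ED]].
have [C oC CE] := oE.
exists [:: (h, y h)]; split; first by move=> k b; rewrite inE => /eqP[-> ->].
move=> z zh; apply: ED; rewrite -CE /= (zh h (y h)) ?inE //.
by rewrite -CE in Ey.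
Qed.

Lemma borel_decided (A : set (free_part n)) : borel_set A -> decided A.
Proof.
apply: smallest_sub => [|{}A oA p pc].
  split.
  - move=> p pc; exists [::]; split=> //.
    by left; rewrite setI0; apply: thin0.
  - by move=> B dB; rewrite setTD; apply: decidedC.
  - exact: decided_bigcup.
have [[q [qc qA]]|no] := pselect (exists q, consistent (q ++ p) /\
    fcyl (q ++ p) `<=` A).
  exists q; split=> //; right; apply: thin_sub thin0 => x [/qA Ax nA].
  exact: nA.
exists [::]; split=> //; left; apply: thin_sub thin0 => x [xp Ax].
have [q [qx qA]] := open_pattern oA Ax; apply: no; exists q.
split; first by exists (val x); apply/fits_cat.
by move=> z /fits_cat[zq _]; apply: qA.
Qed.

Lemma nonthin_cyl (A : set (free_part n)) : decided A -> ~ thin A ->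
  exists p, consistent p /\ thin (fcyl p `&` ~` A).
Proof.
move=> dA nA; apply: contrapT => no; apply: nA.
have -> : A = fcyl [::] `&` A.
  by rewrite [RHS]setIC; apply/seteqP; split=> [x|x []].
apply: thin_local => q qc.
have [q' [qc' [qt|qt]]] := dA _ qc; first by exists q'.
by case: no; exists (q' ++ q ++ [::]).
Qed.

(** Topological transitivity: [A] is comeagre on some cylinder, hence on all its
    translates by multiples of [g]. These translates cover a dense open set,
    since two finite patterns are compatible once one of them is shifted far
    enough. *)
Lemma invariant_thinC g (A : set (free_part n)) : g != 0 ->
  (forall x, A x -> A (act g x)) -> (forall x, A (act g x) -> A x) ->
  decided A -> ~ thin A -> thin (~` A).
Proof.
move=> g0 Ag Agv dA nA; have [p [[y py] pt]] := nonthin_cyl dA nA.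
have AgM k x : A (act (g *+ k) x) -> A x.
  elim: k => [|k IH]; first by rewrite mulr0n act0.
  by rewrite mulrS -actD => /Agv.
pose U := [set z | exists k : nat, fits p (shift (g *+ k) z)].
have Uf : generic U.
  move=> q [z zq].
  have [M MP] := pattern_bound (p ++ q).
  (* A shift by 2 M or more moves p off all the coordinates of norm below M. *)
  pose G := g *+ (2 * M); have GM : (2 * M <= nrm G)%N by apply: nrm_mulrn.
  exists (shift_pattern (- G) p).
  have E w : fits (shift_pattern (- G) p ++ q) w <->
      fits p (shift G w) /\ fits q w.
    by rewrite fits_cat -{1}(shiftKN G w) fits_shift.
  split; last by move=> w /E[]; exists (2 * M)%N.
  exists (fun h => if (nrm h < M)%N then z h else y (h - G)); apply/E; split.
    move=> h b hb.
    have hM : (nrm h < M)%N by apply: (MP h b); rewrite mem_cat hb.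
    rewrite /shift addrK; case: ifP => [|_]; last exact: py.
    have := nrmD (h + G) (- h); rewrite addrAC subrr add0r nrmN; lia.
  move=> h b hb; have hM : (nrm h < M)%N.
    by apply: (MP h b); rewrite mem_cat hb orbT.
  by rewrite hM; apply: zq.
apply: (@thin_sub _ ([set x | ~ U (val x)] `|`
    [set x | exists k : nat, (fcyl p `&` ~` A) (act (g *+ k) x)])).
  move=> x nAx; have [[k kx]|nU] := pselect (U (val x)); last by left.
  by right; exists k; split=> // /AgM.
apply: thinU; first exact: thin_genericC.
by apply: thin_ex => k; apply: thin_act.
Qed.

End Category.

(** * The tournament on five vertices *)

Lemma arc5_asymmetric : asymmetric_arcs arc5.
Proof.
move=> a b [->|->] [] /eqP; rewrite -addrA -{1}(addr0 a) (inj_eq (addrI a)).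
all: by [].
Qed.

Lemma arc5_irreflexive a : ~ arc5 a a.
Proof. by move=> aa; apply: (arc5_asymmetric aa). Qed.

Definition rotational5 : orientedGraph 'Z_5 :=
  @OrientedGraph _ (Digraph arc5_irreflexive) arc5_asymmetric.

Lemma borel_of_orbit_borel n (P : free_part n -> Prop) :
  orbit_borel P -> borel_set [set x | P x].
Proof.
move=> /(_ 0); congr borel_set.
by apply/seteqP; split=> x /=; rewrite act0.
Qed.

Lemma schreier_arcE n (x y : free_part n) :
  schreier_arc x y <-> exists i, y = act (gen i) x.
Proof.
split=> [[i yE]|[i ->]]; exists i => //.
exact: val_inj.
Qed.

Lemma borel_hom_rotational5 n : (0 < n)%N ->
  borel_oriented_sizes (schreier_graph n) 5.
Proof.
move=> n0; exists 'Z_5, rotational5; split; first by rewrite card_ord.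
exists (@colour n).
  move=> B; apply: (@borel_of_orbit_borel n (fun x => B (colour x))).
  apply: (@eq_orbit_borel n (fun x => exists c, B c /\ colour x = c)).
    by move=> x; split=> [[c [Bc ->]]|Bx] //; exists (colour x).
  apply: orbit_borel_ex => c; apply: orbit_borel_and;
    first exact: orbit_borel_cst.
  exact: orbit_borel_colour.
by move=> x y /schreier_arcE[i ->]; apply: colour_arc.
Qed.

(** * Oriented graphs with at most four vertices *)

Section Twins.
Variables (W : finType) (H : orientedGraph W).
Implicit Types (a b c u v : W).

Definition linked a b : Prop :=
  (exists u, H u a /\ H u b) /\ (exists v, H a v /\ H b v).

Definition twin a b : Prop := a = b \/ linked a b.

Lemma arc_neq a b : H a b -> a <> b.
Proof. by move=> /[swap] ->; apply: arc_irreflexive. Qed.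

Lemma arc_anti a b : H a b -> H b a -> False.
Proof. exact: arc_asymmetric. Qed.

Hypothesis W4 : (#|W| <= 4)%N.

(** If [u] and [v] witness that [a] and [b] are linked, then [a], [b], [u] and
    [v] are all the vertices. A third vertex [c] linked to [b] is then [u] or
    [v], and every possible witness for [b] and [c] contradicts asymmetry. *)
Lemma linked_unique a b c : a <> b -> b <> c ->
  linked a b -> linked b c -> a = c.
Proof.
move=> ab bc [[u [ua ub]] [v [av bv]]] [[u' [u'b u'c]] [v' [bv' cv']]].
have uv : u <> v by move=> e; rewrite e in ua; apply: (arc_anti ua av).
have all4 z : [\/ z = a, z = b, z = u | z = v].
  have : z \in [:: a; b; u; v].
    apply: contraT => zs; suff : (5 <= #|W|)%N by rewrite leqNgt ltnS W4.
    have us : uniq [:: z; a; b; u; v].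
      rewrite cons_uniq zs /= !inE !negb_or !andbT -!andbA.
      do ![apply/andP; split]; apply/eqP => //.
      - by move=> e; apply: (arc_neq ua).
      - exact: arc_neq av.
      - by move=> e; apply: (arc_neq ub).
      - exact: arc_neq bv.
    by rewrite -[5%N]/(size [:: z; a; b; u; v]) -(card_uniqP us) max_card.
  rewrite !inE => /or4P[]/eqP ->;
    by [apply: Or41|apply: Or42|apply: Or43|apply: Or44].
case: (all4 c) => // ce; first by case: bc.
  rewrite ce in u'c; case: (all4 u') => u'e; rewrite u'e in u'b u'c.
  - by case: (arc_anti u'c ua).
  - by case: (arc_neq u'b).
  - by case: (arc_neq u'c).
  - by case: (arc_anti u'b bv).
rewrite ce in cv'; case: (all4 v') => v'e; rewrite v'e in bv' cv'.
- by case: (arc_anti cv' av).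
- by case: (arc_neq bv').
- by case: (arc_anti bv' ub).
- by case: (arc_neq cv').
Qed.

Lemma twin_sym a b : twin a b -> twin b a.
Proof.
case=> [->|[[u [? ?]] [v [? ?]]]]; first by left.
by right; split; [exists u|exists v].
Qed.

Lemma twin_trans a b c : twin a b -> twin b c -> twin a c.
Proof.
case=> [->|lab] // [<-|lbc]; first by right.
have [ab|/eqP ab] := eqVneq a b; first by rewrite ab; right.
have [bc|/eqP bc] := eqVneq b c; first by rewrite -bc; right.
by left; apply: (linked_unique ab bc lab lbc).
Qed.

Lemma no_twin_path a b c : H a b -> H b c -> twin a b -> twin b c -> False.
Proof.
move=> Hab Hbc [/(arc_neq Hab)//|lab] [/(arc_neq Hbc)//|lbc].
have ac := linked_unique (arc_neq Hab) (arc_neq Hbc) lab lbc.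
by rewrite -ac in Hbc; apply: (arc_anti Hab Hbc).
Qed.

End Twins.

(** * The Borel oriented chromatic number *)
Lemma borel_hom_card_ge5 n (W : finType) (H : orientedGraph W)
    (f : free_part n -> W) :
  (1 < n)%N -> borel_to_finite f -> graph_hom (schreier_graph n) H f ->
  (5 <= #|W|)%N.
Proof.
move=> n1 fB fH; rewrite leqNgt; apply/negP => W4; rewrite ltnS in W4.
have fE i x : H (f x) (f (act (gen i) x)) by apply: fH; exists i.
pose e0 := gen (Ordinal (ltnW n1)); pose e1 := gen (Ordinal n1).
have ftwin x : twin H (f (act e0 x)) (f (act e1 x)).
  right; split; first by exists (f x); split; apply: fE.
  exists (f (act e0 (act e1 x))); split; last exact: fE.
  by rewrite actD addrC -actD; apply: fE.
(* the points whose colour is in the class of w, an invariant set *)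
pose A w : set (free_part n) := [set x | twin H w (f x)].
have [w nAw] : exists w, ~ thin (A w).
  apply: contrapT => /forallNP nA.
  have tA : thin [set x | exists w, A w x].
    by apply: thin_ex => w; apply: contrapT; apply: nA.
  have [|x [_ nx]] := @baire_free n _ [::] tA; first by exists (fun=> false).
  by apply: nx; exists (f x); left.
have e01 : e0 - e1 != 0.
  by apply/eqP => /rowP /(_ (Ordinal n1)); rewrite !mxE.
have step x : twin H (f (act (e0 - e1) x)) (f x).
  have := ftwin (act (- e1) x).
  by rewrite !actD subrr act0.
have tC : thin (~` A w).
  apply: (invariant_thinC e01) nAw.
  - by move=> x wx; apply: (twin_trans W4) wx (twin_sym (step x)).
  - by move=> x wx; apply: (twin_trans W4) wx (step x).
  - by apply: borel_decided; apply: (fB [set b | twin H w b]).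
have [|x [_ nx]] := @baire_free n _ [::] (thinU tC
    (thinU (thin_act e0 tC) (thin_act e0 (thin_act e0 tC)))).
  by exists (fun=> false).
move: nx => /not_orP[/contrapT wx /not_orP[/contrapT wy /contrapT wz]].
apply: (no_twin_path W4 (fE (Ordinal (ltnW n1)) x)
  (fE (Ordinal (ltnW n1)) (act e0 x))).
  by apply: (twin_trans W4) (twin_sym wx) wy.
by apply: (twin_trans W4) (twin_sym wy) wz.
Qed.

Theorem theorem1p2 (n : nat) (hn : (1 < n)%N) :
  @chi_Bo (free_part n) (schreier_graph n) 5.
Proof.
split; first by apply: borel_hom_rotational5; apply: ltnW.
by move=> m [W [H [<- [f fB fH]]]]; apply: borel_hom_card_ge5 fB fH.
Qed.
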